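(* Let $S$ be a finite nonabelian simple group, let $H$ be a subgroup of $S$, and let $\mathcal{V}=\mathrm{Var}(S)$. Then $$\mathrm{dom}_S^{\mathcal{V}}(H)=\Bigl\{\, s\in S \;\Bigm|\; \text{for all } \phi\in\mathrm{Aut}(S),\ \text{if } \phi|_H=\mathrm{id}_H \text{ then } \phi(s)=s \,\Bigr\}.$$
   Context: A variety of groups is a class of groups (regarded as a full subcategory of the category of all groups) closed under taking quotients, subgroups and arbitrary direct products. $\mathrm{Var}(S)$ denotes the variety generated by $S$, i.e. the smallest variety containing $S$. Given a variety $\mathcal{V}$, a group $G\in\mathcal{V}$ and a subgroup $H\le G$, the dominion of $H$ in $G$ in $\mathcal{V}$ is $$\mathrm{dom}_G^{\mathcal{V}}(H)=\{a\in G \mid \text{for all } C\in\mathcal{V} \text{ and all homomorphisms } f,g\colon G\to C,\ \text{if } f|_H=g|_H \text{ then } f(a)=g(a)\}.$$ *)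

(* Defs.v *)
From HB Require Import structures.
From mathcomp Require Import all_boot all_fingroup all_solvable.
From mathcomp Require Import boolp classical_sets.

Set Implicit Arguments.
Unset Strict Implicit.
Unset Printing Implicit Defensive.

Local Open Scope group_scope.

Definition full_product (I : Type) (G : I -> groupType) : Type :=
  forall i, G i.

Section FullProduct.
Variables (I : Type) (G : I -> groupType).

Let mul (x y : full_product G) : full_product G := fun i => x i * y i.
Let one : full_product G := fun i => 1.
Let inv (x : full_product G) : full_product G := fun i => (x i)^-1.

Let mulA : associative mul.
Proof. by move=> x y z; apply/functional_extensionality_dep=> i; apply: mulgA. Qed.
Let mul1 : left_id one mul.
Proof. by move=> x; apply/functional_extensionality_dep=> i; apply: mul1g. Qed.
Let mulr1 : right_id one mul.
Proof. by move=> x; apply/functional_extensionality_dep=> i; apply: mulg1. Qed.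
Let mulV : left_inverse one inv mul.
Proof. by move=> x; apply/functional_extensionality_dep=> i; apply: mulVg. Qed.
Let mulrV : right_inverse one inv mul.
Proof. by move=> x; apply/functional_extensionality_dep=> i; apply: mulgV. Qed.

HB.instance Definition _ := gen_eqMixin (full_product G).
HB.instance Definition _ := gen_choiceMixin (full_product G).
HB.instance Definition _ := isGroup.Build (full_product G)
  mulA mul1 mulr1 mulV mulrV.
End FullProduct.

(* Quotients and subgroups are taken up to isomorphism: the quotients of G are
   the targets of the surjective homomorphisms from G, and its subgroups are the
   sources of the injective homomorphisms to G.  Between groups, multiplicative
   maps are exactly the homomorphisms. *)
Record is_variety (V : groupType -> Prop) : Prop := IsVariety {
  variety_quotient : forall (G Q : groupType) (f : {multiplicative G -> Q}),
    V G -> (forall y : Q, exists x : G, f x = y) -> V Q;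
  variety_subgroup : forall (G K : groupType) (f : {multiplicative K -> G}),
    V G -> injective f -> V K;
  variety_product : forall (I : Type) (G : I -> groupType),
    (forall i, V (G i)) -> V (full_product G)
}.

Definition Var (S G : groupType) : Prop :=
  forall V : groupType -> Prop, is_variety V -> V S -> V G.

Lemma Var_variety (S : groupType) : is_variety (Var S).
Proof.
split.
- by move=> G Q f VG sf V HV VS; apply: (variety_quotient HV (VG V HV VS) sf).
- by move=> G K f VG fI V HV VS; apply: (variety_subgroup HV (VG V HV VS) fI).
- by move=> I G VG V HV VS; apply: (variety_product HV) => i; apply: VG.
Qed.

Lemma Var_self (S : groupType) : Var S S.
Proof. by []. Qed.

Definition dominion (V : groupType -> Prop) (G : groupType) (H : set G) :
    set G :=
  [set a | forall C : groupType, V C -> forall f g : {multiplicative G -> C},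
     (forall h, H h -> f h = g h) -> f a = g a]%classic.
Arguments dominion V G H : clear implicits.

(* Main.v *)
(** Since the codomain satisfies the laws of [S], [f(S)] and [g(S)] lie in a
    quotient [L / N], where [L] is a subgroup of a finite power of [S].  A
    maximal normal subgroup with nonabelian quotient behaves like a prime ideal
    in the lattice of normal subgroups.  Applied to the preimage of [f(S)] in
    [L], this shows that [f(S)] already comes from the subgroup [F] of the
    elements that are trivial at every coordinate not mapping [L] onto [S];
    applied to [F], each of whose coordinates is onto or trivial, it shows that
    [N] is cut out in [F] by coordinate kernels.  Hence the coordinates separate
    the points of [F / N], and [f(s) = g(s)] need only be tested after composing
    with homomorphisms to [S]: these make [f] and [g] endomorphisms of [S], i.e.
    trivial maps or automorphisms, agreeing on [H]. *)
From HB Require Import structures.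
Require Import Defs.
From mathcomp Require Import boolp classical_sets.
From mathcomp Require Import all_boot all_fingroup all_solvable.

Set Implicit Arguments.
Unset Strict Implicit.
Unset Printing Implicit Defensive.

Local Open Scope group_scope.

(** * Maximal normal subgroups with nonabelian quotient *)

Section MaxNormal.
Variables (gT : finGroupType) (G : {group gT}).
Implicit Types A B M N : {group gT}.

Lemma maxnormal_mulg M A :
  maxnormal M G G -> A <| G -> ~~ (A \subset M) -> A * M = G.
Proof.
move=> maxM nsAG not_sAM; have nsMG := maxnormal_normal maxM.
have [_ /(_ (A <*> M)%G)] := maxgroupP maxM.
have nMA : A \subset 'N(M) by rewrite (subset_trans (normal_sub nsAG)) ?normal_norm.
rewrite /= norm_joinEl // => max.
have sG : A * M \subset G by rewrite mul_subG ?normal_sub.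
apply/eqP; rewrite eqEsubset sG /=; apply: contraR not_sAM => not_sG.
rewrite -max ?mulG_subl ?mulG_subr //.
by rewrite properE sG not_sG -norm_joinEl //= normsY ?normal_norm.
Qed.

(** If neither [A] nor [B] lies in [M], both map onto [G / M]; since their commutator lies in
    [A :&: B], hence in [M], the quotient [G / M] commutes with itself. *)
Lemma maxnormal_prime M A B :
    maxnormal M G G -> ~~ abelian (G / M) -> A <| G -> B <| G ->
  A :&: B \subset M -> (A \subset M) || (B \subset M).
Proof.
move=> maxM nabM nsAG nsBG sABM; apply: contraR nabM.
rewrite negb_or => /andP[/(maxnormal_mulg maxM nsAG) defA].
move=> /(maxnormal_mulg maxM nsBG) defB.
have nMG := normal_norm (maxnormal_normal maxM).
have [nMA nMB] : A \subset 'N(M) /\ B \subset 'N(M).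
  by split; apply: subset_trans nMG; apply: normal_sub.
have qA : A / M = G / M by rewrite -defA quotientMidr.
have qB : B / M = G / M by rewrite -defB quotientMidr.
rewrite /abelian -{1}qA -qB quotient_cents2 // (subset_trans _ sABM) // commg_subI //.
  by rewrite subsetI subxx (subset_trans (normal_sub nsAG)) ?normal_norm.
by rewrite subsetI subxx (subset_trans (normal_sub nsBG)) ?normal_norm.
Qed.

Variables (I : finType) (K : I -> {group gT}).
Hypothesis nsKG : forall i, K i <| G.
Implicit Type J : {set I}.

Lemma bigcapI_normal J : G :&: \bigcap_(i in J) K i <| G.
Proof.
rewrite /normal subsetIl normsI ?normG // norms_bigcap //.
by apply/bigcapsP=> i _; rewrite normal_norm.
Qed.

Lemma bigcapI_setD1 J j : j \in J ->
  G :&: \bigcap_(i in J) K i = K j :&: (G :&: \bigcap_(i in J :\ j) K i).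
Proof. by move=> Jj; rewrite (big_setD1 j Jj) /= setICA. Qed.

(** Shrink [J] to a minimal [J0] whose intersection is still in [M]. It is nonempty because [M] is
    proper; primality applied to [K j] and the remaining intersection leaves only [K j], by
    minimality. *)
Lemma maxnormal_prime_bigcap M J :
    maxnormal M G G -> ~~ abelian (G / M) ->
    G :&: \bigcap_(i in J) K i \subset M ->
  exists2 i, i \in J & K i \subset M.
Proof.
move=> maxM nabM.
pose capK J' := G :&: \bigcap_(i in J') K i.
move/(@minset_exists _ (fun J' => capK J' \subset M))
  => -[J0 /minsetP[/= sJ0M minJ0] sJ0J].
rewrite {}/capK in sJ0M minJ0.
have [J00 | [j J0j]] := set_0Vmem J0.
  move: sJ0M; rewrite J00 big_set0 setIT => sGM.
  by have := maxgroupp maxM; rewrite properE sGM andbF.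
exists j; first exact: (subsetP sJ0J).
move: sJ0M; rewrite (bigcapI_setD1 J0j) => /(maxnormal_prime maxM nabM (nsKG j)).
move/(_ (bigcapI_normal (J0 :\ j)))/orP; case=> // /minJ0.
by move/(_ (subsetDl _ _))/setP/(_ j); rewrite !inE eqxx J0j.
Qed.

(** Again take [J0] minimal with intersection inside [N]; the point is that [N] then lies in each
    [K j] with [j] in [J0]. Minimality also discards every index with [K j = G]. *)
Lemma normal_bigcap N J :
    (forall i, i \in J -> K i != G ->
       maxnormal (K i) G G /\ ~~ abelian (G / K i)) ->
    N <| G -> G :&: \bigcap_(i in J) K i \subset N ->
  exists2 J0 : {set I}, J0 \subset J &
    N = G :&: \bigcap_(i in J0) K i :> {set gT}.
Proof.
move=> maxK nsNG.
pose capK J' := G :&: \bigcap_(i in J') K i.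
move/(@minset_exists _ (fun J' => capK J' \subset N))
  => -[J0 /minsetP[sJ0N minJ0] sJ0J].
rewrite {}/capK in sJ0N minJ0.
have minJ0' j : j \in J0 -> ~~ (G :&: \bigcap_(i in J0 :\ j) K i \subset N).
  move=> J0j; apply/negP=> /minJ0/(_ (subsetDl _ _))/setP/(_ j).
  by rewrite !inE eqxx J0j.
have ntK j : j \in J0 -> K j != G.
  move=> J0j; apply: contra (minJ0' j J0j) => /eqP defKj.
  move: sJ0N; rewrite (bigcapI_setD1 J0j) defKj; apply: subset_trans.
  by rewrite subsetI subsetIl subxx.
exists J0 => //; apply/eqP; rewrite eqEsubset sJ0N andbT.
rewrite subsetI normal_sub //=; apply/bigcapsP=> j J0j.
have [maxKj nabKj] := maxK j (subsetP sJ0J j J0j) (ntK j J0j).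
apply: contraR (minJ0' j J0j) => not_sNK.
pose R := (G :&: \bigcap_(i in J0 :\ j) K i)%G; rewrite -[_ :&: _]/(gval R).
have nsRG : R <| G by apply: bigcapI_normal.
have sKRN : K j :&: R \subset N by rewrite /= -bigcapI_setD1.
have not_sRK : ~~ (R \subset K j).
  by apply: contra (minJ0' j J0j) => sRK; rewrite (subset_trans _ sKRN) // subsetI sRK /=.
(* Primality and maximality of [K j] give [(R :&: N) * K j = G]; Dedekind's modular law then puts
   [R] inside [N], so that [j] could be dropped from [J0]. *)
have not_sRNK : ~~ (R :&: N \subset K j).
  apply/negP=> /(maxnormal_prime maxKj nabKj nsRG nsNG).
  by rewrite (negPf not_sRK) (negPf not_sNK).
have defG : (R :&: N) * K j = G.
  by apply: (@maxnormal_mulg _ (R :&: N)%G) => //; apply: normalI.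
have: R \subset (R :&: N) * (K j :&: R).
  by rewrite group_modl ?subsetIl // defG subsetI subxx andbT normal_sub.
by move/subset_trans; apply; rewrite mul_subG ?subsetIr.
Qed.
End MaxNormal.

(** * Homomorphisms from [S] into sections of its finite powers *)

Section SubdirectPower.
Variable S : finGroupType.
Hypotheses (simpleS : simple [set: S]) (nonabelianS : ~~ abelian [set: S]).

Lemma simple_hom_cases (rT : finGroupType) (f : {morphism [set: S] >-> rT}) :
  'injm f \/ f @* [set: S] = 1.
Proof.
have [_ /(_ _ (ker_normal f))[] kerf] := simpleP _ simpleS.
  by left; rewrite kerf.
by right; have := morphim_ker f; rewrite kerf.
Qed.

Variables (H : {group S}) (s : S).
Hypothesis fix_s : forall phi : {perm S}, phi \in Aut [set: S] ->
  {in H, forall h, phi h = h} -> phi s = s.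

(** If both are automorphisms, [v] followed by the inverse of [u] fixes [H] pointwise, hence fixes
    [s]. If one is trivial, a nontrivial element of [H] forces the other to be trivial too. If [H]
    is trivial, inner automorphisms show that [s] is central, so [s = 1]. *)
Lemma endomorphism_eq (u v : {morphism [set: S] >-> S}) :
  {in H, u =1 v} -> u s = v s.
Proof.
move=> uvH; have trivH : H :=: 1 -> s = 1.
  move=> H1; have [_ /(_ _ (center_normal [set: S]))[]] := simpleP _ simpleS.
    move=> Z1; apply/set1gP; rewrite -Z1 inE in_setT; apply/centP=> x Sx.
    apply/commgP/conjg_fixP; rewrite -(conj_autE Sx (in_setT s)).
    apply: fix_s => [|h]; first exact: Aut_aut.
    by rewrite H1 => /set1P->; rewrite conj_autE ?conj1g.
  by move/center_idP=> abS; case/negP: nonabelianS.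
have triv (w : {morphism [set: S] >-> S}) : w @* [set: S] = 1 -> forall x, w x = 1.
  by move=> w1 x; apply/set1gP; rewrite -w1 mem_morphim.
have [s1 | ntH] := eqVneq (H : {set S}) 1; first by rewrite trivH // !morph1.
have [h Hh nth] := trivgPn _ ntH.
have ninj (w w' : {morphism [set: S] >-> S}) :
    {in H, w =1 w'} -> w @* [set: S] = 1 -> w' @* [set: S] = 1.
  move=> ww' w1; have [injw'|//] := simple_hom_cases w'.
  case/eqP: nth; apply: (injmP injw'); rewrite ?inE //.
  by rewrite -ww' // triv // morph1.
have [[inju|u1] [injv|v1]] := (simple_hom_cases u, simple_hom_cases v).
- have onto (w : {morphism [set: S] >-> S}) : 'injm w -> w @* [set: S] = [set: S].
    by move=> injw; apply/eqP; rewrite eqEcard subsetT (card_injm injw (subxx _)) leqnn.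
  pose a := aut injv (onto v injv); pose b := aut inju (onto u inju).
  have aE x : a x = v x by rewrite autE ?inE.
  have bE x : b x = u x by rewrite autE ?inE.
  rewrite -aE -bE -[a s](permKV b) -(permM a); congr (b _); apply: esym (fix_s _ _).
    by rewrite groupM ?groupV ?Aut_aut.
  by move=> h' Hh'; rewrite permM aE -uvH // -bE permK.
- by rewrite (triv v) // (triv u) // (ninj v) // => z Hz; rewrite uvH.
- by rewrite (triv u) // (triv v) // (ninj u).
- by rewrite !triv.
Qed.

Variables (gT : finGroupType) (L N : {group gT}) (I : finType).
Variable p : I -> {morphism L >-> S}.
Hypotheses (nsNL : N <| L) (sKN : L :&: \bigcap_i 'ker (p i) \subset N).

Let onto := [set i | p i @* L == [set: S]].
Let F := (L :&: \bigcap_(i in ~: onto) 'ker (p i))%G.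

Lemma sub_core_quotient (f : {morphism [set: S] >-> coset_of N}) :
  f @* [set: S] \subset L / N -> f @* [set: S] \subset F / N.
Proof.
have [injf sfL | -> _] := simple_hom_cases f; last exact: sub1G.
have [P defP sNP sPL] := inv_quotientS nsNL sfL.
have isoP : [set: S] \isog P / N by rewrite -defP sub_isog.
have nsNP : N <| P := normalS sNP sPL nsNL.
have maxN : maxnormal N P P.
  by rewrite -quotient_simple // -(isog_simple isoP).
have nabN : ~~ abelian (P / N) by rewrite -(isog_abelian isoP).
pose K i := (P :&: 'ker (p i))%G.
have nsKP i : K i <| P := normalGI sPL (ker_normal _).
rewrite defP; have [sFN | not_sFN] := boolP (P :&: F \subset N).
  have [|i] := maxnormal_prime_bigcap nsKP (J := ~: onto) maxN nabN.
    apply: subset_trans sFN; rewrite /= (setIA P) (setIidPl sPL) setIS //.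
    by apply/bigcapsP=> i Ji; rewrite (bigcap_min i) ?subsetIr.
  (* With [P :&: 'ker (p i)] inside [N], the order of [S], which is the index of [N] in [P], is at
     most that of [p i @* P]; so [p i] would be onto. *)
  rewrite !inE => /negP not_onto sKiN; case: not_onto; rewrite eqEcard subsetT /=.
  apply: leq_trans (subset_leq_card (morphimS _ sPL)).
  rewrite (card_isog isoP) card_quotient ?normal_norm //.
  rewrite card_morphim (setIidPr sPL) -[leqRHS]indexgI.
  by rewrite dvdn_leq // indexgS.
have nsFP : (P :&: F)%G <| P.
  apply: normalGI sPL _; rewrite (bigcapI_normal (K := fun i => 'ker (p i))%G) // => j.
  exact: ker_normal.
rewrite -(maxnormal_mulg maxN nsFP not_sFN) quotientMidr quotientS //.
exact: subsetIr.
Qed.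

(** For [i] in [onto], [p i @* F] is normal in [p i @* L = [set: S]], so it is trivial or
    everything: the kernel of [p i] on [F] is [F] itself or has quotient isomorphic to [S], as
    [normal_bigcap] requires. *)
Lemma core_normal_bigcap :
  exists J : {set I}, F :&: N = F :&: \bigcap_(i in J) 'ker (p i).
Proof.
have sFL : F \subset L := subsetIl _ _.
have nsFL : F <| L.
  by rewrite (bigcapI_normal (K := fun i => 'ker (p i))%G) // => i; exact: ker_normal.
pose K i := (F :&: 'ker (p i))%G.
have nsKF i : K i <| F := normalGI sFL (ker_normal _).
have [i|||J _ defN] := normal_bigcap nsKF (N := (F :&: N)%G) (J := onto).
- rewrite inE => /eqP ontoi ntK.
  have isoF : F / K i \isog [set: S].
    suffices <- : p i @* F = [set: S] by apply: first_isog_loc.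
    have [_ /(_ (p i @* F)%G)[]] := simpleP _ simpleS.
    + by have := morphim_normal (p i) nsFL; rewrite ontoi.
    + move/trivgP=> /= pF1; case/eqP: ntK; apply/val_inj/setIidPl.
      by rewrite ker_trivg_morphim sFL.
    by [].
  by rewrite -quotient_simple // (isog_simple isoF) (isog_abelian isoF).
- exact: normalGI sFL nsNL.
(* Elements of [F] are already trivial at the coordinates outside [onto], so intersecting over
   [onto] is enough. *)
- rewrite subsetI subsetIl (subset_trans _ sKN) // subsetI.
  rewrite (subset_trans (subsetIl _ _)) //=; apply/bigcapsP=> i _.
  have [Ji | notJi] := boolP (i \in onto).
    by rewrite subIset // orbC (bigcap_min i) ?subsetIr.
  apply: subset_trans (subsetIl _ _) (subset_trans (subsetIr _ _) _).
  by rewrite (bigcap_min i) // inE.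
exists J; rewrite defN; apply/setP=> x; apply/setIP/setIP=> -[Fx /bigcapP Kx];
  split=> //; apply/bigcapP=> i Ji.
  by have /setIP[] := Kx i Ji.
by apply/setIP; split=> //; apply: Kx.
Qed.

Lemma hom_quotient_eq (f g : {morphism [set: S] >-> coset_of N}) :
    f @* [set: S] \subset L / N -> g @* [set: S] \subset L / N ->
  {in H, f =1 g} -> f s = g s.
Proof.
move=> /sub_core_quotient sf /sub_core_quotient sg fgH.
have sFL : F \subset L := subsetIl _ _.
have nNF : F \subset 'N(N) := subset_trans sFL (normal_norm nsNL).
have [J defN] := core_normal_bigcap.
have /morphimP[x nNx Fx fs] : f s \in F / N
  by rewrite (subsetP sf) ?mem_morphim ?inE.
have /morphimP[y nNy Fy gs] : g s \in F / N
  by rewrite (subsetP sg) ?mem_morphim ?inE.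
rewrite fs gs; apply/eqP; rewrite eq_mulgV1 -morphV // -morphM ?groupV //.
apply/eqP/coset_id; suffices: x * y^-1 \in F :&: N by case/setIP.
rewrite defN; apply/setIP; split; first by rewrite groupM ?groupV.
apply/bigcapP=> i Ji.
(* As [F :&: N] lies in the kernel of [p i], this coordinate factors on [F] through [F / N];
   composing the factor [r] with [f] and [g] gives endomorphisms of [S]. *)
have sK : 'ker (restrm nNF (coset N)) \subset 'ker (restrm sFL (p i)).
  by rewrite !ker_restrm ker_coset defN setIS // (bigcap_min i).
pose r := factm_morphism sK (subxx F).
have rE z : z \in F -> r (coset N z) = p i z by apply: factmE.
have comp_morph (h : {morphism [set: S] >-> coset_of N}) :
    h @* [set: S] \subset F / N -> {morph r \o h : a b / a * b}.
  move=> sh a b; have dom c : h c \in restrm nNF (coset N) @* F.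
    by rewrite restrm_quotientE // (subsetP sh) ?mem_morphim ?inE.
  by rewrite /comp (morphM h) ?inE //; apply: (morphM r).
pose u := @Morphism _ _ [set: S] _ (in2W (comp_morph f sf)).
pose v := @Morphism _ _ [set: S] _ (in2W (comp_morph g sg)).
have uvs : u s = v s by apply: endomorphism_eq => z Hz; rewrite /= fgH.
have pxy : p i x = p i y.
  by rewrite -!rE //; move: uvs; rewrite /u /v /= fs gs.
have [Lx Ly] : x \in L /\ y \in L by rewrite !(subsetP sFL).
by apply/kerP; rewrite ?groupM ?groupV // morphM ?groupV // morphV // pxy mulgV.
Qed.
End SubdirectPower.

(** * Laws and the variety they define *)

Section WordLaws.
Variable X : Type.

(** Words carry no inverses: in a finite group, a subset containing 1 and closed under products is
    already a subgroup. *)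
Definition word_eval (G : groupType) (c : X -> G) (w : seq X) : G :=
  \prod_(x <- w) c x.

Lemma word_eval_cat (G : groupType) (c : X -> G) w1 w2 :
  word_eval c (w1 ++ w2) = word_eval c w1 * word_eval c w2.
Proof. exact: big_cat. Qed.

Lemma word_eval1 (G : groupType) (c : X -> G) x : word_eval c [:: x] = c x.
Proof. exact: big_seq1. Qed.

Lemma word_eval_comp (G K : groupType) (f : {multiplicative G -> K})
    (c : X -> G) w :
  f (word_eval c w) = word_eval (f \o c) w.
Proof.
have f1 : f 1 = 1 by apply: (mulgI (f 1)); rewrite -gmulfM !mulg1.
exact: (big_morph f gmulfM f1).
Qed.

Definition word_law (G : groupType) (w1 w2 : seq X) : Prop :=
  forall c : X -> G, word_eval c w1 = word_eval c w2.

Definition satisfies_laws_of (S G : groupType) : Prop :=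
  forall w1 w2 : seq X, word_law S w1 w2 -> word_law G w1 w2.

(** The easy half of Birkhoff's theorem. As [Var S] is the least variety containing [S], all its
    members satisfy the laws of [S]. For quotients, the assignment of the letters is lifted along
    the surjection by choice. *)
Lemma satisfies_laws_of_variety (S : groupType) :
  is_variety (satisfies_laws_of S).
Proof.
split=> [G Q f VG surjf | G K f VG injf | I G VG] w1 w2 Sw c.
- have [d dE] := choice (fun x => surjf (c x)).
  have -> : c = f \o d by apply/funext=> x; rewrite /= dE.
  by rewrite -!word_eval_comp (VG _ _ Sw).
- by apply: injf; rewrite !word_eval_comp (VG _ _ Sw).
- apply: functional_extensionality_dep => i.
  have evalE w : word_eval c w i = word_eval (fun x => c x i) w.
    by elim: w => [|x w]; rewrite /word_eval ?big_nil // !big_cons => <-.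
  by rewrite !evalE; apply: VG.
Qed.
End WordLaws.

(* The free group of [Var S] on [X], realised inside the power of [S] indexed by
   the maps [X -> S]; its elements are values of monoid words because it is
   finite. *)
Section RelativelyFree.
Variables (S : finGroupType) (X : finType).

Let power := {dffun forall a : {ffun X -> S}, S}.
Definition relfree_gen (x : X) : power := [ffun a : {ffun X -> S} => a x].

Lemma relfree_group_set :
  group_set [set u : power | `[< exists w, u = word_eval relfree_gen w >]].
Proof.
apply/group_setP; split=> [|u v]; rewrite !inE.
  by apply/asboolP; exists [::]; rewrite /word_eval big_nil.
move=> /asboolP[w ->] /asboolP[w' ->]; apply/asboolP; exists (w ++ w').
by rewrite word_eval_cat.
Qed.
Definition relfree := Group relfree_group_set.

Lemma relfreeP u : reflect (exists w, u = word_eval relfree_gen w) (u \in relfree).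
Proof. by rewrite inE; apply: asboolP. Qed.

Lemma relfree_gen_in x : relfree_gen x \in relfree.
Proof. by apply/relfreeP; exists [:: x]; rewrite word_eval1. Qed.

Lemma word_eval_relfree_gen w (a : {ffun X -> S}) :
  word_eval relfree_gen w a = word_eval a w.
Proof.
elim: w => [|x w]; rewrite /word_eval ?big_nil ?ffunE // !big_cons => <-.
by rewrite !ffunE.
Qed.

(** Choose a word for each element and evaluate it at [c]. Two words with equal values at the
    generators agree at every coordinate, that is, under every assignment in [S]; they form a law of
    [S], which [C] obeys. Outside [relfree] the chosen word is arbitrary, so [q] is multiplicative
    only on [relfree]. *)
Lemma relfree_universal (C : groupType) (c : X -> C) :
    satisfies_laws_of X S C ->
  exists q : power -> C,
    {in relfree &, {morph q : u v / u * v}} /\ forall x, q (relfree_gen x) = c x.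
Proof.
move=> lawsC.
have /choice[wd wdE] u : exists w, u \in relfree -> u = word_eval relfree_gen w.
  have [/relfreeP[w uE] | notu] := boolP (u \in relfree); first by exists w.
  by exists [::].
have evalE w w' : word_eval relfree_gen w = word_eval relfree_gen w' ->
    word_eval c w = word_eval c w'.
  move=> eqww'; apply: lawsC => d.
  have := congr1 (fun u : power => u [ffun x => d x]) eqww'.
  rewrite !word_eval_relfree_gen (_ : fun_of_fin _ = d) //.
  by apply/funext=> x; rewrite ffunE.
exists (fun u => word_eval c (wd u)); split=> [u v Lu Lv | x].
  rewrite -word_eval_cat; apply: evalE.
  by rewrite word_eval_cat -!wdE ?groupM.
rewrite -[RHS](word_eval1 c); apply: evalE.
by rewrite word_eval1 -wdE ?relfree_gen_in.
Qed.

Definition relfree_eval (a : {ffun X -> S}) :=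
  restrm_morphism (subsetT relfree) (dffun_morphism (fun=> S) a).

Lemma bigcap_ker_relfree_eval :
  relfree :&: \bigcap_a 'ker (relfree_eval a) = 1.
Proof.
apply/trivgP/subsetP=> u /setIP[Lu /bigcapP Ku]; apply/set1gP/ffunP=> a.
by rewrite [RHS]ffunE; have /mker := Ku a isT.
Qed.
End RelativelyFree.
Arguments relfree_gen {S X} x.

(** * Passage from an arbitrary target in [Var S] to a finite quotient of [relfree] *)

Theorem theorem2p8 (S : finGroupType) (H : {group S})
    (simpleS : simple [set: S]%SET) (nonabelianS : ~~ abelian [set: S]%SET) :
  dominion (Var S) S [set x : S | x \in H]%classic =
  [set s : S | forall phi : {perm S}, phi \in Aut [set: S]%SET ->
     {in H, forall h, phi h = h} -> phi s = s]%classic.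
Proof.
apply/seteqP; split=> [s doms phi Aphi fixH | s /= fix_s C VC f g fgH].
  (* The test pair is the identity and [phi], both with target [S] itself. *)
  have phiM : {morph phi : x y / x * y}.
    by move=> x y; apply: (morphicP (Aut_morphic Aphi)); rewrite inE.
  pose phi' : {multiplicative S -> S} :=
    HB.pack (phi : S -> S) (isMultiplicative.Build S S phi phiM).
  by apply/esym; apply: (doms S (@Var_self S) idfun phi') => h /fixH.
(* One generator for each value of [f] and one for each value of [g], so that a single finite group
   [L] covers both images. *)
pose c (x : S + S) := match x with inl t => f t | inr t => g t end.
have lawsC : satisfies_laws_of (S + S) S C.
  by apply: (VC _ (satisfies_laws_of_variety (S + S) S)) => w1 w2.
have [q [qM qgen]] := relfree_universal c lawsC.
set L := relfree _ _ in qM.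
have q1 : q 1 = 1 by apply: (mulgI (q 1)); rewrite -qM ?mulg1.
(* [N] is the kernel of [q] on [L], built by hand because [C] may be infinite; [coset_eq] below says
   that [q] embeds [L / N] into [C]. *)
have group_N : group_set [set u in L | q u == 1].
  apply/group_setP; split; first by apply/setIdP; rewrite group1 q1.
  move=> u v /setIdP[Lu /eqP qu] /setIdP[Lv /eqP qv]; apply/setIdP.
  by rewrite groupM // qM // qu qv mulg1.
pose N := Group group_N.
have sNL : N \subset L by apply/subsetP=> u /setIdP[].
have qV u : u \in L -> q u^-1 = (q u)^-1.
  by move=> Lu; apply/(mulgI (q u)); rewrite -qM ?groupV // !mulgV.
have nsNL : N <| L.
  apply/andP; split=> //; apply/subsetP=> u Lu; rewrite inE.
  apply/subsetP=> _ /imsetP[v /setIdP[Lv /eqP qv] ->].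
  apply/setIdP; split; first exact: groupJ.
  by rewrite conjgE !qM ?groupM ?groupV // qV // qv mul1g mulVg.
have nNL u : u \in L -> u \in 'N(N) by apply/subsetP/normal_norm.
have coset_eq u v : u \in L -> v \in L -> (coset N u = coset N v) <-> q u = q v.
  move=> Lu Lv; split=> [/eqP|quv].
    rewrite eq_mulgV1 -morphV ?nNL // -morphM ?groupV ?nNL //.
    move/eqP/coset_idr; rewrite groupM ?groupV ?nNL // => /(_ isT)/setIdP[_ /eqP].
    rewrite qM ?groupV // qV // => quv.
    by apply: (mulIg (q v)^-1); rewrite quv mulgV.
  apply/eqP; rewrite eq_mulgV1 -morphV ?nNL // -morphM ?groupV ?nNL //.
  apply/eqP/coset_id/setIdP; rewrite groupM ?groupV //; split=> //.
  by rewrite qM ?groupV // qV // quv mulgV.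
(* Sending [t] to its generator is not multiplicative in [L], but it becomes so modulo [N], where
   equality can be tested after [q]. *)
have morph_lift (h : {multiplicative S -> C}) (k : S -> S + S) :
    (forall t, c (k t) = h t) ->
    {in [set: S] &, {morph (fun t => coset N (relfree_gen (k t))) : a b / a * b}}.
  move=> kE a b _ _; rewrite -morphM ?nNL ?relfree_gen_in //.
  apply/coset_eq; rewrite ?groupM ?relfree_gen_in //.
  by rewrite qM ?relfree_gen_in // !qgen !kE gmulfM.
pose f' := Morphism (morph_lift f inl (fun=> erefl)).
pose g' := Morphism (morph_lift g inr (fun=> erefl)).
have sub_lift (k : S -> S + S) (h : {morphism [set: S] >-> coset_of N}) :
    (forall t, h t = coset N (relfree_gen (k t))) -> h @* [set: S] \subset L / N.
  move=> hE; apply/subsetP=> _ /morphimP[t _ _ ->]; rewrite hE.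
  by rewrite mem_quotient ?relfree_gen_in.
have sKN : L :&: \bigcap_a 'ker (@relfree_eval S _ a) \subset N.
  by rewrite bigcap_ker_relfree_eval sub1G.
have: f' s = g' s.
  apply: (hom_quotient_eq simpleS nonabelianS fix_s nsNL sKN).
  - exact: (sub_lift inl).
  - exact: (sub_lift inr).
  move=> t Ht; apply/coset_eq; rewrite ?relfree_gen_in // !qgen /=.
  exact: fgH.
by move/coset_eq; rewrite ?relfree_gen_in // !qgen; apply.
Qed.
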